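(* Let $n \ge 3$ be an integer, let $p$ be a prime and $\ell \ge 1$ an integer, and let $\Gamma=\mathrm{Cay}(\mathbb{Z}_n, S)$ be a connected, non-complete circulant graph of order $n$ and degree $|S| = p^{\ell}-1$. Then $\Gamma$ admits a perfect code if and only if $p^{\ell}$ divides $n$ and $S_0 = S\cup\{0\}$ is a pyramidal set of $\mathbb{Z}_n$. Moreover, suppose $p^{\ell}$ divides $n$, $S_0$ is pyramidal and aperiodic, and $2t$ is the length of the longest admissible subgroup series of $\mathbb{Z}_n$ associated with $S_0$. Then: (a) if $(S_0-S_0)\cap \langle p^\ell \rangle=\{0\}$, then the subgroup $\langle p^\ell \rangle$ of $\mathbb{Z}_n$ is a perfect code in $\Gamma$ containing $0$; furthermore, when $t=1$ this is the only perfect code in $\Gamma$ containing $0$, whilst when $t > 1$ there are perfect codes in $\Gamma$ containing $0$ which are not subgroups of $\mathbb{Z}_n$; (b) if $(S_0-S_0)\cap \langle p^\ell \rangle\neq\{0\}$, then there are perfect codes in $\Gamma$ containing $0$, but none of them is the subgroup $\langle p^\ell \rangle$ of $\mathbb{Z}_n$.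
   Context: Groups are written additively. For an abelian group $G$ and an inverse-closed $S\subseteq G\setminus\{0\}$, $\mathrm{Cay}(G,S)$ has vertex set $G$, with $x,y$ adjacent iff $x-y\in S$; $S_0=S\cup\{0\}$. A perfect code in a graph is a set $D$ of vertices such that every vertex is at distance at most $1$ from exactly one vertex of $D$. For $A,B\subseteq G$, $A-B=\{a-b: a\in A,b\in B\}$. For a subgroup $H$ and $X\subseteq G$, $X/H=\{x+H: x\in X\}\subseteq G/H$. A nonzero $a\in G$ with $X+a=X$ is a period of $X$; the periods together with $0$ form the subgroup of periods $G_X$. $X$ is periodic if $G_X\neq\{0\}$ and aperiodic otherwise; $X$ is called $K$-periodic (for a nontrivial subgroup $K$) when $K$ is its subgroup of periods. Pyramidal set: a subset $X$ of an abelian group $G$ with $0\in X$ is pyramidal if there is a subgroup series $H_0 < H_1 < \cdots < H_{2t-1} \le H_{2t} = G$ with $t\ge 1$ such that either (a) $H_0=\{0\}$, $X$ is aperiodic, and (T1) $(X/H_{2i}-X/H_{2i})\cap (H_{2i+1}/H_{2i})=\{0\}$ in $G/H_{2i}$ for $0\le i\le t-1$; (T2) $X/H_{2i-1}$ is $(H_{2i}/H_{2i-1})$-periodic in $G/H_{2i-1}$ for $1\le i\le t$; (T3) $|X/H_{2t-1}|=|G/H_{2t-1}|$ and $|X/H_{2i}|=|X/H_{2i+1}|$ for $0\le i\le t-1$; or (b) $H_0\neq\{0\}$, $X$ is $H_0$-periodic, and $X/H_0$ satisfies (T1)–(T3) in $G/H_0$ with respect to the series $\{0\}=H_0/H_0<H_1/H_0<\cdots<H_{2t-1}/H_0\le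 H_{2t}/H_0=G/H_0$. Such a series is called an admissible subgroup series of $G$ of length $2t$ associated with $X$. *)

(* Defs.v *)
From HB Require Import structures.
From mathcomp Require Import all_boot all_order all_algebra all_fingroup.

Set Implicit Arguments.
Unset Strict Implicit.
Unset Printing Implicit Defensive.

Local Open Scope group_scope.

(* Finite groups are written multiplicatively here. On 'Z_n the group law is
   the addition, so 1, x * y^-1, A * B^-1 and X / H below are, respectively,
   0, x - y, A - B and the image of X in the quotient by H. *)

Section Graphs.

Variable T : finType.
Implicit Types (e : rel T) (D : {set T}).

Definition dist_le e (k : nat) (x y : T) : Prop :=
  exists s : seq T, [/\ path e x s, last x s = y & (size s <= k)%N].

Definition perfect_code e D : Prop :=
  forall x : T, exists! d : T, d \in D /\ dist_le e 1 x d.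

Definition connected_graph e : Prop := forall x y : T, connect e x y.

Definition complete_graph e : Prop := forall x y : T, x != y -> e x y.

End Graphs.

Definition cay (gT : finGroupType) (S : {set gT}) : rel gT :=
  fun x y => x * y^-1 \in S.

Section Periods.

Variable gT : finGroupType.
Implicit Types (X K : {set gT}).

Definition periods X : {set gT} := [set a | X :* a == X].

Definition aperiodic X : Prop := periods X = 1.

(* K is required to be nontrivial; hence T2 below forces the last inclusion of
   the series, which is only assumed to be weak, to be strict. *)
Definition periodic_with K X : Prop := K != 1 /\ periods X = K.

End Periods.

(* A series is given by its values H 0, ..., H t.*2; the others are unused. *)
Definition subgroup_series (gT : finGroupType) (G : {group gT})
    (t : nat) (H : nat -> {group gT}) : Prop :=
  [/\ forall i, (i < t.*2.-1)%N -> H i \proper H i.+1,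
      H t.*2.-1 \subset H t.*2
    & H t.*2 = G].

Definition T1 (gT : finGroupType) (X : {set gT})
    (t : nat) (H : nat -> {group gT}) : Prop :=
  forall i, (i < t)%N ->
    ((X / H i.*2) * (X / H i.*2)^-1) :&: (H i.*2.+1 / H i.*2) = 1.

Definition T2 (gT : finGroupType) (X : {set gT})
    (t : nat) (H : nat -> {group gT}) : Prop :=
  forall i, (1 <= i <= t)%N ->
    periodic_with (H i.*2 / H i.*2.-1) (X / H i.*2.-1).

Definition T3 (gT : finGroupType) (G : {group gT}) (X : {set gT})
    (t : nat) (H : nat -> {group gT}) : Prop :=
  #|X / H t.*2.-1| = #|G / H t.*2.-1| /\
  forall i, (i < t)%N -> #|X / H i.*2| = #|X / H i.*2.+1|.

Definition T123 (gT : finGroupType) (G : {group gT}) (X : {set gT})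
    (t : nat) (H : nat -> {group gT}) : Prop :=
  [/\ T1 X t H, T2 X t H & T3 G X t H].

Definition admissible (gT : finGroupType) (G : {group gT}) (X : {set gT})
    (t : nat) (H : nat -> {group gT}) : Prop :=
  [/\ (1 <= t)%N, subgroup_series G t H
    & [/\ H 0 = 1 :> {set gT}, aperiodic X & T123 G X t H] \/
      [/\ H 0 <> 1 :> {set gT}, periodic_with (H 0) X
        & T123 (G / H 0)%G (X / H 0) t (fun i => H i / H 0)%G]].

Definition pyramidal (gT : finGroupType) (G : {group gT}) (X : {set gT}) :
    Prop :=
  [/\ abelian G, X \subset G, 1 \in X & exists t H, admissible G X t H].

Definition longest_half_length (gT : finGroupType) (G : {group gT})
    (X : {set gT}) (t : nat) : Prop :=
  (exists H, admissible G X t H) /\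
  (forall t' H', admissible G X t' H' -> (t' <= t)%N).

(* Main.v *)
Require Import Defs.
From HB Require Import structures.
From mathcomp Require Import all_boot all_order all_algebra all_fingroup.
From mathcomp Require Import cyclic pgroup.

(* A perfect code D of Cay(G, S) is the same thing as a tiling S0 + D = G.

   If G = A + B is a tiling, then so is G = kA + B for every k prime to |A|
   (Tijdeman), so no nonzero difference of B is a multiple k(a - a') with k
   prime to |A|. When G is cyclic and |A| is a power of a prime p, this forces
   A or B to be periodic (Sands): comparing the p-parts of the differences of A
   and of B with the subgroup C of order p, one finds that A or B is a union of
   C-cosets, unless A has two elements whose difference has its p-part in C and
   a nontrivial p'-part h, in which case B is a union of cosets of a subgroup
   of <h> of prime order.

   Hence, starting from an aperiodic S0, one can alternately divide by the
   periods of D, which are not differences of S0, and by those of the image of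
   S0; the kernels of the successive projections form an admissible series.
   Conversely, a tiling complement is lifted back along an admissible series:
   the first kind of step takes a full preimage, the second one a transversal.
   The freedom in the choice of the transversal yields codes that are not
   subgroups when t > 1. *)

Set Implicit Arguments.
Unset Strict Implicit.
Unset Printing Implicit Defensive.

Import GroupScope.

(** * Factorizations of a finite group into two subsets *)

Section Tiling.

Variable gT : finGroupType.
Implicit Types (A B X : {set gT}).

Definition tiling A B : Prop := A * B = [set: gT] /\ (#|A| * #|B| = #|gT|)%N.

Lemma tiling_inj A B a a' b b' : tiling A B ->
  a \in A -> a' \in A -> b \in B -> b' \in B -> a * b = a' * b' ->
  a = a' /\ b = b'.
Proof.
case=> AB cAB aA a'A bB b'B eq_ab.
have inj : {in setX A B &, injective (fun u => u.1 * u.2)}.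
  apply/imset_injP; rewrite cardsX cAB -cardsT -AB; apply/eqP/eq_card => g.
  apply/imsetP/mulsgP => [[[x y] /setXP[xA yB] ->] | [x y xA yB ->]].
    by exists x y.
  by exists (x, y); rewrite // inE /= xA.
by have := inj (a, b) (a', b'); rewrite !inE /= aA a'A bB b'B => /(_ isT isT eq_ab)[].
Qed.

Lemma tilingP A B :
  (forall a a' b b', a \in A -> a' \in A -> b \in B -> b' \in B ->
     a * b = a' * b' -> a = a') ->
  A * B = [set: gT] -> tiling A B.
Proof.
move=> inj AB; split=> //; rewrite -cardsX -cardsT -AB.
have <- : [set u.1 * u.2 | u in setX A B] = A * B.
  apply/setP => g; apply/imsetP/mulsgP => [[[x y] /setXP[xA yB] ->] | [x y xA yB ->]].
    by exists x y.
  by exists (x, y); rewrite // inE /= xA.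
rewrite card_in_imset // => -[a b] [a' b'] /setXP[aA bB] /setXP[a'A b'B] /= e.
have aa' := inj _ _ _ _ aA a'A bB b'B e; move: e; rewrite aa'.
by move/mulgI->.
Qed.

Lemma tiling_neq0 A B : tiling A B -> exists a b, a \in A /\ b \in B.
Proof.
by case=> AB _; have /mulsgP[a b aA bB _] : 1 \in A * B by [rewrite AB inE]; exists a, b.
Qed.

Lemma tiling_decomp A B g : tiling A B -> exists a b, [/\ a \in A, b \in B & g = a * b].
Proof.
by case=> AB _; have /mulsgP[a b aA bB ->] : g \in A * B by [rewrite AB inE]; exists a, b.
Qed.

End Tiling.

(** * Tijdeman's theorem, through the regular representation *)

Section Tijdeman.

Variable gT : finGroupType.
Hypothesis abG : abelian [set: gT].
Implicit Types (A B : {set gT}).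

Lemma mulgC_abelian (x y : gT) : x * y = y * x.
Proof. by apply: (centsP abG); rewrite inE. Qed.

Let n := #|gT|.-1.
Let card_gT : #|gT| = n.+1.
Proof. by rewrite prednK // -cardsT cardG_gt0. Qed.

Let ev (i : 'I_n.+1) : gT := enum_val (cast_ord (esym card_gT) i).
Let ve (g : gT) : 'I_n.+1 := cast_ord card_gT (enum_rank g).

Let evK : cancel ve ev.
Proof. by move=> g; rewrite /ev /ve cast_ordK enum_rankK. Qed.

Let veK : cancel ev ve.
Proof. by move=> g; rewrite /ev /ve enum_valK cast_ordKV. Qed.

Section RegularRepresentation.

Variable F : nzRingType.

Local Open Scope ring_scope.

Definition regmx (g : gT) : 'M[F]_n.+1 :=
  \matrix_(i, j) ((ev i * g)%g == ev j)%:R.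

Lemma regmxM g h : regmx (g * h)%g = regmx g * regmx h.
Proof.
apply/matrixP => i k; rewrite !mxE (bigD1 (ve (ev i * g)%g)) //= !mxE evK eqxx.
rewrite GRing.mul1r mulgA big1 ?GRing.addr0 // => j nj; rewrite !mxE.
case: eqP => [e | _]; last by rewrite GRing.mul0r.
by rewrite e veK eqxx in nj.
Qed.

Lemma regmxX g k : regmx (g ^+ k)%g = regmx g ^+ k.
Proof.
elim: k => [|k IH]; last by rewrite expgS regmxM IH GRing.exprS.
by rewrite expg0 GRing.expr0; apply/matrixP => i j; rewrite !mxE mulg1 (can_eq veK).
Qed.

Lemma regmxC g h : regmx g * regmx h = regmx h * regmx g.
Proof. by rewrite -!regmxM mulgC_abelian. Qed.

(** Entries of such sums count solutions of equations in the group, so over ['F_r] a matrix identity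
    becomes a congruence of counts modulo [r]. *)
Lemma sum_regmxE (I : finType) (Q : pred I) (f : I -> gT) i j :
  (\sum_(x | Q x) regmx (f x)) i j
    = #|[pred x | Q x && ((ev i * f x)%g == ev j)]|%:R.
Proof.
rewrite summxE -sum1_card GRing.natr_sum big_mkcond [RHS]big_mkcond /=.
apply: eq_bigr => x _; rewrite inE mxE.
by case: (Q x) => //=; case: eqP.
Qed.

End RegularRepresentation.

Local Open Scope ring_scope.

(** In characteristic [r] the [r]-th power is additive on commuting matrices, and the matrices
    representing an abelian group commute. *)
Lemma sum_regmx_Frobenius (r : nat) (I : finType) (Q : pred I) (f : I -> gT) :
  prime r ->
  (\sum_(x | Q x) regmx 'F_r (f x)) ^+ r = \sum_(x | Q x) regmx 'F_r (f x ^+ r)%g.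
Proof.
move=> pr_r; have ch : r \in [pchar 'M['F_r]_n.+1].
  by rewrite GRing.pchar_lalg pchar_Fp.
rewrite -(GRing.pFrobenius_autE ch).
suff [] : GRing.pFrobenius_aut ch (\sum_(x | Q x) regmx 'F_r (f x))
            = \sum_(x | Q x) regmx 'F_r (f x ^+ r)%g
       /\ forall h, GRing.comm (regmx 'F_r h) (\sum_(x | Q x) regmx 'F_r (f x)) by [].
elim/big_rec2: _ => [|x u v _ [IH cu]].
  by split=> [|h]; [exact: GRing.pFrobenius_aut0 | exact: GRing.commr0].
split=> [|h]; last by apply: GRing.commrD; [exact: regmxC | exact: cu].
by rewrite GRing.pFrobenius_autD_comm ?IH ?regmxX //; apply: cu.
Qed.

(* Modulo r, the r-th power of the element \sum_(a in A) a of the group algebra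
   is \sum_(a in A) a ^+ r; hence the number of solutions of g = a ^+ r * b is
   congruent to #|A| ^ r.-1, which is nonzero. *)
Lemma tiling_prime_exp A B (r : nat) : prime r -> ~~ (r %| #|A|)%N ->
  tiling A B -> forall g, exists a b, [/\ a \in A, b \in B & g = (a ^+ r * b)%g].
Proof.
move=> pr_r rA tAB g.
pose M (Z : {set gT}) := \sum_(x in Z) regmx 'F_r x.
have MAB : M A * M B = M setT.
  rewrite /M GRing.mulr_suml.
  under eq_bigr do rewrite GRing.mulr_sumr.
  rewrite pair_big_dep /=.
  under eq_bigr do rewrite -regmxM.
  apply/matrixP => i j; rewrite !sum_regmxE; congr (_%:R).
  transitivity 1%N.
    have [a [b [aA bB e]]] := tiling_decomp ((ev i)^-1 * ev j)%g tAB.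
    apply: (@eq_card1 _ (a, b)) => -[a' b']; rewrite !inE /=.
    apply/andP/eqP => [[/andP[a'A b'B] /eqP e'] | [-> ->]].
      have [|-> ->] := tiling_inj tAB a'A aA b'B bB _; last by [].
      by rewrite -e -e' mulKg.
    by rewrite aA bB -e mulKVg eqxx.
  apply/esym/(@eq_card1 _ ((ev i)^-1 * ev j)%g) => x; rewrite !inE /=.
  by rewrite -(inj_eq (mulgI (ev i)^-1%g)) mulKg.
have MT x : regmx 'F_r x * M setT = M setT.
  rewrite /M GRing.mulr_sumr [RHS](reindex_inj (mulgI x)) /=.
  by apply: eq_big => y; rewrite ?inE // regmxM.
have MAT k : M A ^+ k * M setT = M setT *+ #|A| ^ k.
  elim: k => [|k IH]; first by rewrite GRing.expr0 GRing.mul1r.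
  rewrite GRing.exprSr -GRing.mulrA expnS GRing.mulrnA.
  have -> : M A * M setT = M setT *+ #|A|.
    rewrite {1}/M GRing.mulr_suml; under eq_bigr do rewrite MT.
    by rewrite GRing.sumr_const.
  by rewrite GRing.mulrnAr IH -!GRing.mulrnA mulnC.
have MrB : \sum_(u in setX A B) regmx 'F_r (u.1 ^+ r * u.2)%g = M setT *+ #|A| ^ r.-1.
  rewrite -MAT -MAB GRing.mulrA -GRing.exprSr prednK ?prime_gt0 //.
  rewrite sum_regmx_Frobenius // GRing.mulr_suml.
  under [RHS]eq_bigr do rewrite GRing.mulr_sumr.
  rewrite [RHS]pair_big_dep /=.
  by apply: eq_big => u; rewrite ?inE // regmxM.
have /matrixP/(_ (ve 1%g) (ve g)) := MrB.
rewrite mulmxnE !sum_regmxE !evK -GRing.mulrnA.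
have -> : #|[pred x in [set: gT] | (1 * x)%g == g]| = 1%N.
  by apply: (@eq_card1 _ g) => x; rewrite !inE mul1g.
rewrite mul1n => e.
have : #|[pred x in setX A B | (1 * (x.1 ^+ r * x.2))%g == g]| != 0%N.
  apply: contraNneq rA => c0; move: e; rewrite c0 => /esym/eqP.
  rewrite -(GRing.dvdn_pcharf (pchar_Fp pr_r)) Euclid_dvdX //; by case/andP.
rewrite -lt0n => /card_gt0P[[a b]]; rewrite !inE mul1g /= => /andP[/andP[aA bB] /eqP <-].
by exists a, b.
Qed.

Local Open Scope group_scope.

Definition expg_set A k : {set gT} := [set a ^+ k | a in A].

Lemma mem_expg_set A k a : a \in A -> a ^+ k \in expg_set A k.
Proof. exact: (imset_f (fun x => x ^+ k)). Qed.

(** Strong induction on [k], removing one prime factor [r] at a time. The powers [a ^+ r] still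
    cover the group together with [B], so there must be [#|A|] of them; this gives both the tiling
    and the injectivity. *)
Lemma tiling_expg A B k : (0 < k)%N -> coprime k #|A| -> tiling A B ->
  tiling (expg_set A k) B /\ {in A &, injective (fun a => a ^+ k)}.
Proof.
elim/ltn_ind: k A => k IH A k_gt0 co tAB.
have [k_le1 | k_gt1] := leqP k 1%N.
  have -> : k = 1%N by apply/eqP; rewrite eqn_leq k_le1.
  have -> : expg_set A 1 = A.
    by apply/setP=> x; apply/imsetP/idP => [[a aA ->]|xA] //; exists x.
  by split.
have [r pr_r rk] : exists2 r, prime r & (r %| k)%N.
  by exists (pdiv k); [exact: pdiv_prime | exact: pdiv_dvd].
have rA : ~~ (r %| #|A|)%N.
  rewrite -prime_coprime //; exact: coprime_dvdl rk co.
have surj := tiling_prime_exp pr_r rA tAB.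
have prodT : expg_set A r * B = setT.
  apply/setP=> g; rewrite inE; have [a [b [aA bB ->]]] := surj g.
  by rewrite mem_mulg // mem_expg_set.
have card_le : (#|expg_set A r| <= #|A|)%N := leq_imset_card _ _.
have cardA : #|expg_set A r| = #|A|.
  apply/eqP; rewrite eqn_leq card_le /=.
  have B_gt0 : (0 < #|B|)%N.
    by have [a [b [_ bB]]] := tiling_neq0 tAB; apply/card_gt0P; exists b.
  rewrite -(leq_pmul2r B_gt0); case: tAB => _ ->.
  rewrite -cardsT -prodT -cardsX.
  apply: leq_trans (leq_imset_card (fun u => u.1 * u.2) _); apply: subset_leq_card.
  by apply/subsetP=> g /mulsgP[x y xA yB ->]; apply/imsetP; exists (x, y); rewrite // inE /= xA.
have tr : tiling (expg_set A r) B by split; rewrite // cardA; case: tAB.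
have injr : {in A &, injective (fun a => a ^+ r)} by apply/imset_injP; rewrite -cardA.
have kE : k = (r * (k %/ r))%N by rewrite mulnC divnK.
have [|||t inj] := IH (k %/ r)%N _ (expg_set A r) _ _ tr.
- by rewrite ltn_Pdiv ?prime_gt1.
- by rewrite divn_gt0 ?prime_gt0 // dvdn_leq.
- rewrite cardA; apply: (@coprime_dvdl _ k) co.
  by apply/dvdnP; exists r.
split.
  have -> // : expg_set A k = expg_set (expg_set A r) (k %/ r)%N.
  rewrite /expg_set -imset_comp; apply: eq_imset => a /=.
  by rewrite -expgM -kE.
move=> a a' aA a'A /= e; apply: injr => //; apply: inj; rewrite ?mem_expg_set //=.
by rewrite -!expgM -kE.
Qed.

End Tijdeman.

(** * The periods of a set as a group *)

Section PeriodGroup.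

Variables (gT : finGroupType) (X : {set gT}).

Lemma group_set_periods : group_set (periods X).
Proof.
apply/group_setP; split=> [|a b]; first by rewrite inE rcoset1.
by rewrite !inE rcosetM => /eqP -> ->.
Qed.
Canonical periods_group := Group group_set_periods.

Lemma mem_mul_periods x z : z \in periods X -> x \in X -> x * z \in X.
Proof. by rewrite inE => /eqP {2}<- xX; rewrite mem_rcoset mulgK. Qed.

Lemma stable_periods z : (forall x, x \in X -> x * z \in X) -> z \in periods X.
Proof.
move=> sX; rewrite inE eqEcard card_rcoset leqnn andbT.
by apply/subsetP => _ /rcosetP[x xX ->]; apply: sX.
Qed.

Lemma periodsP z : reflect (forall x, x \in X -> x * z \in X) (z \in periods X).
Proof.
apply: (iffP idP) => [zX x | ]; first exact: mem_mul_periods.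
exact: stable_periods.
Qed.

End PeriodGroup.

(** * Sands' theorem for a factor of prime power size in a cyclic group *)

Section Sands.

Variables (gT : finGroupType) (p : nat).
Hypotheses (cycG : cyclic [set: gT]) (p_pr : prime p).
Variables A B : {set gT}.
Hypotheses (tAB : tiling A B) (pA : p.-nat #|A|).

Let abG : abelian [set: gT] := cyclic_abelian cycG.
Let mulC (x y : gT) : x * y = y * x := mulgC_abelian abG x y.

Lemma sub_cycle_dvdn (x y : gT) : #[x] %| #[y] -> x \in <[y]>.
Proof.
by move=> xy; rewrite -cycle_subG -(cardSg_cyclic cycG) ?subsetT.
Qed.

(** If the [p]-part of the difference [d] were trivial, the order of [d] would be an exponent prime
    to [#|A|] that identifies [a] and [a']. *)
Lemma tiling_diff_constt a a' : a \in A -> a' \in A -> a != a' -> (a * a'^-1).`_p != 1.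
Proof.
move=> aA a'A; apply: contraNneq => d1.
set d := a * a'^-1 in d1.
have pd : p^'.-elt d by apply/constt1P.
have co : coprime #[d] #|A| by rewrite coprime_sym; apply: pnat_coprime pA pd.
have [_ inj] := tiling_expg abG (order_gt0 d) co tAB.
apply/eqP; apply: inj => //=.
by rewrite -{1}[a](mulgKV a') -/d expgMn ?expg_order ?mul1g //; apply: mulC.
Qed.

(* Up to an exponent prime to #|A|, u * v is a difference of A. *)
Lemma tiling_diff_neq a a' b b' u v :
  a \in A -> a' \in A -> b \in B -> b' \in B -> a != a' ->
  <[u]> = <[(a * a'^-1).`_p]> -> v \in <[(a * a'^-1).`_p^']> ->
  u * v <> b * b'^-1.
Proof.
move=> aA a'A bB b'B ne_a; have := tiling_diff_constt aA a'A ne_a.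
set d := a * a'^-1 => d_n1 eq_u /cycleP[j ->] e.
have /cycleP[i ui] : u \in <[d.`_p]> by rewrite -eq_u cycle_id.
have co_i : coprime #[d.`_p] i by rewrite -generator_coprime -ui /generator eq_u.
have co_d : coprime #[d.`_p] #[d.`_p^'].
  exact: pnat_coprime (p_elt_constt _ _) (p_elt_constt _ _).
(* By the Chinese remainder theorem [d ^+ k] is the prescribed product. This [k] is prime to [p]
   because [u] generates the same nontrivial group as the [p]-part of [d]. *)
pose k := chinese #[d.`_p] #[d.`_p^'] i j.
have co_k : coprime #[d.`_p] k.
  by rewrite -coprime_modr chinese_modl // coprime_modr.
have p_d : p %| #[d.`_p].
  have : #[d.`_p] != 1%N by rewrite order_eq1.
  have /p_natP[m ->] : p.-nat #[d.`_p] := p_elt_constt _ _.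
  by case: m => [|m] //; rewrite expnS dvdn_mulr.
have co_pk : coprime p k := coprime_dvdl p_d co_k.
have k_gt0 : 0 < k by rewrite lt0n; apply: contraTneq co_pk => ->; rewrite /coprime gcdn0 gtn_eqF ?prime_gt1.
have co_kA : coprime k #|A|.
  by have /p_natP[m ->] := pA; rewrite coprime_sym coprimeXl.
have [tk inj] := tiling_expg abG k_gt0 co_kA tAB.
have dk : d ^+ k = b * b'^-1.
  rewrite -e ui -{1}[d](consttC p) expgMn; last exact: mulC.
  by congr (_ * _); apply/eqP; rewrite eq_expg_mod_order ?chinese_modl ?chinese_modr.
have ak : a ^+ k = a'^+ k * (b * b'^-1).
  by rewrite -dk -expgMn; [congr (_ ^+ k); rewrite mulC mulgKV | exact: mulC].
have [] := tiling_inj tk (mem_expg_set k aA) (mem_expg_set k a'A) b'B bB.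
  by rewrite ak -!mulgA mulVg mulg1.
by move/inj => /(_ aA a'A) e'; rewrite e' eqxx in ne_a.
Qed.

(** An exponent that is 1 modulo the [p]-part of the group order and 0 modulo its [p']-part sends
    every [a] to its [p]-part; as [p] divides the order, this exponent is prime to [#|A|]. *)
Lemma tiling_constt_decomp g : p %| #|gT| ->
  exists a b, [/\ a \in A, b \in B & g = a.`_p * b].
Proof.
move=> pG; have N_gt0 : 0 < #|gT| by rewrite -cardsT cardG_gt0.
pose k := chinese #|gT|`_p #|gT|`_p^' 1 0.
have co : coprime #|gT|`_p #|gT|`_p^' by rewrite coprime_partC.
have k1 : k = 1 %[mod #|gT|`_p] by apply: chinese_modl.
have k0 : k = 0 %[mod #|gT|`_p^'] by apply: chinese_modr.
have p_part : p %| #|gT|`_p by rewrite p_part -{1}(expn1 p) dvdn_exp2l // logn_gt0 mem_primes p_pr N_gt0.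
have co_pk : coprime p k.
  apply: coprime_dvdl p_part _; rewrite -coprime_modr k1 coprime_modr; exact: coprimen1.
have k_gt0 : 0 < k by rewrite lt0n; apply: contraTneq co_pk => ->; rewrite /coprime gcdn0 gtn_eqF ?prime_gt1.
have co_kA : coprime k #|A|.
  by have /p_natP[m ->] := pA; rewrite coprime_sym coprimeXl.
have [tk _] := tiling_expg abG k_gt0 co_kA tAB.
have [_ [b [/imsetP[a aA ->] bB ->]]] := tiling_decomp g tk.
exists a, b; split=> //; congr (_ * _).
have ord_dvd pi : #[a.`_pi] %| #|gT|`_pi.
  by rewrite order_constt partn_dvd // -cardsT order_dvdG ?inE.
rewrite -{1}[a](consttC p) expgMn; last exact: mulC.
have /eqP -> : a.`_p ^+ k == a.`_p ^+ 1.
  by rewrite eq_expg_mod_order -(modn_dvdm _ (ord_dvd p)) k1 modn_dvdm.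
have /eqP -> : a.`_p^' ^+ k == a.`_p^' ^+ 0.
  by rewrite eq_expg_mod_order -(modn_dvdm _ (ord_dvd p^')) k0 modn_dvdm.
by rewrite mulg1.
Qed.

Lemma consttMV pi (x y : gT) : (x * y^-1).`_pi = x.`_pi * (y.`_pi)^-1.
Proof. by rewrite consttM ?consttV //; apply: mulC. Qed.

Section SubgroupOfOrderP.

Variable c : gT.
Hypothesis oc : #[c] = p.

Lemma order_p_p_elt z : z \in <[c]> -> p.-elt z.
Proof. by apply: mem_p_elt; rewrite /pgroup -orderE oc pnat_id. Qed.

Lemma order_p_in_cycle z : p.-elt z -> z != 1 -> c \in <[z]>.
Proof.
move=> /p_natP[m om]; rewrite -order_eq1 om => z1; apply: sub_cycle_dvdn.
by rewrite oc om; case: m z1 om => [|m] // _ _; rewrite expnS dvdn_mulr.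
Qed.

Lemma order_p_generator z : z \in <[c]> -> z != 1 -> <[z]> = <[c]>.
Proof.
move=> zc z1; apply/eqP; rewrite eqEsubset !cycle_subG zc.
by rewrite order_p_in_cycle ?order_p_p_elt.
Qed.

(** Every nontrivial [p]-element generates a group containing [c], so [y] lies both in [<[z]>] and
    in [<[z * y]>]. *)
Lemma cycle_mul_order_p z y : p.-elt z -> z \notin <[c]> -> y \in <[c]> ->
  <[z * y]> = <[z]>.
Proof.
move=> pz zc yc.
have z1 : z != 1 by apply: contraNneq zc => ->; rewrite group1.
have sub_c w : p.-elt w -> w != 1 -> y \in <[w]>.
  by move=> pw w1; apply: subsetP yc; rewrite cycle_subG order_p_in_cycle.
have yz := sub_c z pz z1.
have zy1 : z * y != 1.
  by apply: contraNneq zc => /eqP; rewrite -eq_invg_mul => /eqP zy; rewrite -groupV zy.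
have yzy : y \in <[z * y]>.
  by apply: sub_c zy1; apply: p_eltM (mulC _ _) pz (order_p_p_elt yc).
apply/eqP; rewrite eqEsubset !cycle_subG groupM ?cycle_id //=.
by rewrite -(groupMr _ yzy) cycle_id.
Qed.

End SubgroupOfOrderP.

Theorem periodic_factor : 1 < #|gT| ->
  (exists2 z, z \in periods A & z != 1) \/ (exists2 z, z \in periods B & z != 1).
Proof.
move=> G_gt1; have [pG | pG] := boolP (p %| #|gT|); last first.
  (* When [p] does not divide the order, [A] is a single point, so [B] is the whole group. *)
  have cA : #|A| = 1%N.
    case/p_natP: pA => -[|m] // cA; case/negP: pG.
    by case: tAB => _ <-; rewrite cA expnS -mulnA dvdn_mulr.
  right; have [z] : exists z : gT, z \notin [set 1].
    apply/existsP; rewrite -negb_forall; apply: contraL G_gt1 => /forallP all1.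
    rewrite -leqNgt -(cards1 (1 : gT)) -cardsT subset_leq_card //.
    by apply/subsetP=> x _; apply: all1.
  rewrite inE => z1; exists z => //; apply: stable_periods => b _.
  have /cards1P[a0 A1] : #|A| == 1%N by rewrite cA.
  have [a1 [b1 [a1A b1B e]]] := tiling_decomp (a0 * (b * z)) tAB.
  by move: a1A e; rewrite A1 => /set1P -> /mulgI ->.
have [c _ oc] : {c | c \in [set: gT] & #[c] = p} by apply: Cauchy; rewrite ?cardsT.
have cc := cycle_id c.
have cV : c^-1 \in <[c]> by rewrite groupV.
have c1 : c != 1 by rewrite -order_eq1 oc gtn_eqF ?prime_gt1.
have swap (x y z t : gT) w : x * y * z = t * w -> t * x^-1 * z^-1 = y * w^-1.
  move=> e; apply: (mulIg w); rewrite mulgKV.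
  rewrite -[_ * _ * w]mulgA (mulC z^-1) mulgA -(mulgA t) (mulC x^-1) mulgA -e.
  by rewrite (mulC _ x^-1) -!mulgA mulKg mulgV mulg1.
have [a0 [b00 [a0A _]]] := tiling_neq0 tAB.
(* If two distinct elements of [B] differ by an element of [<[c]>], no nontrivial difference of [A]
   has its [p]-part in [<[c]>]. Multiplying such a [p]-part by [c^-1] then preserves the group it
   generates, which forces [c] to be a period of [B]. *)
case: (boolP [exists b1 in B, exists b2 in B, (b1 != b2) && (b1 * b2^-1 \in <[c]>)]).
  case/exists_inP => b1 b1B /exists_inP[b2 b2B /andP[b12 b12c]].
  right; exists c => //; apply: stable_periods => b0 b0B.
  have [a [b [aA bB e]]] := tiling_decomp (a0 * b0 * c) tAB.
  have [ea | ne_a] := eqVneq a a0.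
    by move: e; rewrite ea -mulgA => /mulgI ->.
  have d1 := tiling_diff_constt aA a0A ne_a.
  have pd := p_elt_constt p (a * a0^-1).
  have [dc | dc] := boolP ((a * a0^-1).`_p \in <[c]>).
    case: (@tiling_diff_neq a a0 b1 b2 (b1 * b2^-1) 1) => //; last exact: mulg1.
    rewrite !(order_p_generator oc) //.
    by rewrite -eq_mulgV1.
  case: (@tiling_diff_neq a a0 b0 b ((a * a0^-1).`_p * c^-1) (a * a0^-1).`_p^') => //.
  - exact: (cycle_mul_order_p oc).
  - exact: cycle_id.
  - by rewrite -(swap _ _ _ _ _ e) mulC mulgA [_.`_p^' * _]mulC consttC.
rewrite negb_exists_in => /forall_inP noB.
have noBP b1 b2 : b1 \in B -> b2 \in B -> b1 * b2^-1 \in <[c]> -> b1 = b2.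
  move=> b1B b2B bc; have := noB _ b1B; rewrite negb_exists_in => /forall_inP/(_ _ b2B).
  by rewrite bc andbT negbK => /eqP.
(* Now [B] meets each coset of [<[c]>] at most once. Hence the [p]-part found here is [c] itself if
   it lies in [<[c]>], and otherwise it contradicts [tiling_diff_neq]. *)
have star a1 : a1 \in A -> exists2 a, a \in A & (a * a1^-1).`_p = c.
  move=> a1A; have [_ [b0 [_ b0B]]] := tiling_neq0 tAB.
  have [a [b [aA bB /swap]]] := tiling_constt_decomp (a1.`_p * b0 * c) pG.
  rewrite -consttMV => e; exists a => //.
  have [dc | dc] := boolP ((a * a1^-1).`_p \in <[c]>).
    have ebb : b0 = b by apply: noBP; rewrite // -e groupM.
    by apply/eqP; rewrite eq_mulgV1 e ebb mulgV.
  case: (@tiling_diff_neq a a1 b0 b ((a * a1^-1).`_p * c^-1) 1) => //.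
  - by apply: contraNneq dc => ->; rewrite mulgV constt1 group1.
  - by rewrite (cycle_mul_order_p oc) ?p_elt_constt.
  - by rewrite mulg1.
(* If the [p']-part is always trivial, then [a = a1 * c] in [star], so [c] is a period of [A]. *)
case: (boolP [exists a1 in A, exists a in A,
   ((a * a1^-1).`_p == c) && ((a * a1^-1).`_p^' != 1)]); last first.
  rewrite negb_exists_in => /forall_inP noA.
  left; exists c => //; apply: stable_periods => a1 a1A.
  have [a aA e] := star a1 a1A; have := noA _ a1A.
  rewrite negb_exists_in => /forall_inP/(_ _ aA); rewrite e eqxx /= negbK => /eqP e'.
  by move: aA; rewrite -[a](mulgKV a1) -(consttC p (a * a1^-1)) e e' mulg1 mulC.
case/exists_inP => a1 a1A /exists_inP[a aA /andP[/eqP e h1]].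
set h := (a * a1^-1).`_p^' in h1.
have [r r_pr rh] : exists2 r, prime r & r %| #[h].
  by exists (pdiv #[h]); rewrite ?pdiv_dvd // pdiv_prime // ltn_neqAle eq_sym order_eq1 h1 /=.
have [rho rho_h o_rho] : {z | z \in <[h]> & #[z] = r} by apply: Cauchy.
right; exists rho; last by rewrite -order_eq1 o_rho gtn_eqF ?prime_gt1.
apply: stable_periods => b0 b0B.
(* Since h is the quotient of the p'-parts of a' / a1 and a' / a, the prime r
   divides the order of one of these, which then serves in tiling_diff_neq. *)
have [a' [b [a'A bB e']]] := tiling_constt_decomp (a1.`_p * b0 * rho) pG.
have [ea | ne_a] := eqVneq a' a1.
  by move: e'; rewrite ea -mulgA => /mulgI ->.
have := swap _ _ _ _ _ e'; rewrite -consttMV => {}e'.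
have d1 := tiling_diff_constt a'A a1A ne_a.
have pd := p_elt_constt p (a' * a1^-1).
(* Inside [<[c]>], the pair [a], [a1] that defines [h] already gives the contradiction. *)
have [dc | dc] := boolP ((a' * a1^-1).`_p \in <[c]>).
  case: (@tiling_diff_neq a a1 b0 b (a' * a1^-1).`_p rho^-1) => //.
  - by apply: contraNneq c1 => ea; rewrite -e ea mulgV constt1.
  - by rewrite e (order_p_generator oc).
  - by rewrite groupV.
have dE : a' * a1^-1 = (a' * a^-1) * (a * a1^-1) by rewrite mulgA mulgKV.
have d2E : (a' * a^-1).`_p = (a' * a1^-1).`_p * c^-1.
  by rewrite dE (consttM p (mulC (a' * a^-1) _)) e mulgK.
have : r %| #[(a' * a1^-1).`_p^'] * #[(a' * a^-1).`_p^'].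
  apply: dvdn_trans rh _; rewrite order_dvdn.
  have -> : h = (a' * a1^-1).`_p^' * ((a' * a^-1).`_p^')^-1.
    by rewrite -consttMV dE (mulC (a' * _)) mulgK.
  rewrite expgMn; last exact: mulC.
  by rewrite expgM expg_order expg1n mul1g expVgn mulnC expgM expg_order expg1n invg1.
rewrite Euclid_dvdM // => /orP[rd | rd].
  case: (@tiling_diff_neq a' a1 b0 b (a' * a1^-1).`_p rho^-1) => //.
  by rewrite groupV sub_cycle_dvdn ?o_rho.
case: (@tiling_diff_neq a' a b0 b (a' * a1^-1).`_p rho^-1) => //.
- apply: contraNneq dc => ea; move/esym/eqP: d2E; rewrite ea mulgV constt1.
  by rewrite -eq_mulgV1 => /eqP ->.
- by rewrite d2E (cycle_mul_order_p oc).
- by rewrite groupV sub_cycle_dvdn ?o_rho.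
Qed.

End Sands.

(** * Quotients of an abelian group, read on saturated subsets *)

Section Quotients.

Variable gT : finGroupType.
Hypothesis abG : abelian [set: gT].
Implicit Types (K : {group gT}) (X E : {set gT}).

Let mulC (x y : gT) : x * y = y * x := mulgC_abelian abG x y.

Lemma abelian_norm K x : x \in 'N(K).
Proof. by apply: (subsetP (sub_abelian_norm abG (subsetT K))); rewrite inE. Qed.

Lemma cosetM K x y : coset K (x * y) = coset K x * coset K y.
Proof. by rewrite morphM ?abelian_norm. Qed.

Lemma eq_coset K x y : (coset K x == coset K y) = (x^-1 * y \in K).
Proof.
apply/eqP/idP => [/kercoset_rcoset[]|xy]; rewrite ?abelian_norm //.
  by move=> z zK ->; rewrite invMg mulC mulgA mulgV mul1g groupV.
by rewrite -(coset_kerr x xy) mulKVg.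
Qed.

Lemma mem_coset_quotient K X x : (coset K x \in X / K) = (x \in X * K).
Proof.
apply/morphimP/mulsgP => [[y _ yX /eqP] | [y k yX kK ->]].
  by rewrite eq_sym eq_coset => xy; exists y (y^-1 * x); rewrite ?mulKVg.
by exists y; rewrite ?abelian_norm // coset_kerr.
Qed.

Lemma mem_coset K X x : x \in X -> coset K x \in X / K.
Proof. by move=> xX; rewrite mem_coset_quotient -[x]mulg1 mem_mulg. Qed.

Lemma quotient_imageP K X u : u \in X / K -> exists2 x, x \in X & u = coset K x.
Proof. by case/morphimP => x _ xX ->; exists x. Qed.

Lemma mem_coset_group K (L : {group gT}) x : K \subset L -> (coset K x \in L / K) = (x \in L).
Proof. by move=> KL; rewrite mem_coset_quotient mulGSid. Qed.

Lemma mem_periods_quotient K X z : (coset K z \in periods (X / K)) = (z \in periods (X * K)).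
Proof.
apply/periodsP/periodsP => pz.
  by move=> x; rewrite -!mem_coset_quotient cosetM; apply: pz.
move=> u; case: (cosetP u) => x _ ->.
by rewrite -cosetM !mem_coset_quotient; apply: pz.
Qed.

Lemma periods_quotientE K (L : {group gT}) X : K \subset L ->
  periods (X / K) = L / K <-> periods (X * K) = L.
Proof.
move=> KL; split=> [e | e]; apply/setP => u.
  by rewrite -mem_periods_quotient e mem_coset_group.
by case: (cosetP u) => x _ ->; rewrite mem_periods_quotient e mem_coset_group.
Qed.

Lemma sub_periods_mul K X : K \subset periods (X * K).
Proof.
apply/subsetP=> k kK; apply/periodsP => _ /mulsgP[x k' xX k'K ->].
by rewrite -mulgA mem_mulg ?groupM.
Qed.

Lemma mul_periods_sub K (L : {group gT}) X :
  K \subset L -> L \subset periods (X * K) -> X * L = X * K.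
Proof.
move=> KL LX; apply/eqP; rewrite eqEsubset (mulgS X KL) andbT.
apply/subsetP=> _ /mulsgP[x l xX lL ->]; apply: mem_mul_periods; first exact: (subsetP LX).
by rewrite -[x]mulg1 mem_mulg.
Qed.

Lemma card_mul_quotient K X : #|X * K| = (#|X / K| * #|K|)%N.
Proof.
rewrite -sum1_card (partition_big (coset K) (mem (X / K))) /=; last first.
  by move=> x; rewrite -mem_coset_quotient.
rewrite -sum_nat_const; apply: eq_bigr => u /quotient_imageP[y yX ->].
rewrite sum1_card -(card_rcoset K y); apply: eq_card => x.
rewrite mem_rcoset unfold_in /= -mem_coset_quotient.
have -> : (x * y^-1 \in K) = (coset K x == coset K y).
  by rewrite eq_sym eq_coset mulC.
by case: eqP => [->|]; rewrite ?andbF // mem_coset.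
Qed.

(** Since [X * L = X * K], the two sizes differ by the factor [#|L : K|]. This keeps the size of a
    projected set a power of [p]. *)
Lemma card_quotient_dvdn K (L : {group gT}) X : K \subset L -> L \subset periods (X * K) ->
  #|X / L| %| #|X / K|.
Proof.
move=> KL LX; apply/dvdnP; exists #|L : K|.
apply/eqP; rewrite -(eqn_pmul2r (cardG_gt0 K)) -card_mul_quotient -(mul_periods_sub KL LX).
by rewrite card_mul_quotient -(Lagrange KL) (mulnC #|K|) mulnA (mulnC #|X / L|).
Qed.

(** Pulls (T1) back to the ambient group, where it can be used along a whole series. *)
Lemma diff_quotientP K (L : {group gT}) X : K \subset L -> 1 \in X ->
  ((X / K) * (X / K)^-1) :&: (L / K) = 1 <->
  (forall x y, x \in X -> y \in X -> x^-1 * y \in L -> x^-1 * y \in K).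
Proof.
move=> KL X1; split=> [e x y xX yX xyL | H].
  have : coset K y * (coset K x)^-1 \in (X / K) * (X / K)^-1 :&: (L / K).
    rewrite inE mem_mulg ?mem_coset ?mem_invg ?invgK ?mem_coset //=.
    by rewrite -morphV ?abelian_norm // -cosetM mem_coset_group // mulC.
  by rewrite e => /set1P/eqP; rewrite -eq_mulgV1 eq_sym eq_coset.
apply/setP=> u; rewrite !inE; apply/andP/eqP => [[] | ->].
  case/mulsgP => v w /quotient_imageP[y yX ->]; rewrite mem_invg => /quotient_imageP[x xX /(canRL invgK) ->] ->.
  rewrite -morphV ?abelian_norm // -cosetM mem_coset_group // mulC => /(H _ _ xX yX).
  exact: coset_id.
split; last exact: group1.
by rewrite -[1](mulgV (coset K 1)) mem_mulg ?mem_invg ?invgK ?mem_coset.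
Qed.

(** The second half of (T3) follows from (T1): the canonical map [f] from [X / K] to [X / L] is
    injective. *)
Lemma card_quotient_inj K (L : {group gT}) X : K \subset L ->
  (forall x y, x \in X -> y \in X -> x^-1 * y \in L -> x^-1 * y \in K) ->
  #|X / K| = #|X / L|.
Proof.
move=> KL H; pose f (u : coset_of K) := coset L (repr u).
have fE x : f (coset K x) = coset L x.
  apply/eqP; rewrite eq_coset (subsetP KL) // -eq_coset; apply/eqP.
  exact: coset_reprK.
have -> : X / L = f @: (X / K).
  apply/setP => u; apply/idP/imsetP => [/quotient_imageP[x xX ->] | [v /quotient_imageP[x xX ->] ->]].
    by exists (coset K x); rewrite ?fE ?mem_coset.
  by rewrite fE mem_coset.
rewrite [RHS]card_in_imset // => u v /quotient_imageP[x xX ->] /quotient_imageP[y yX ->] /eqP.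
by rewrite !fE eq_coset => /(H _ _ xX yX); rewrite -eq_coset => /eqP.
Qed.

End Quotients.

(** * Tilings modulo a subgroup *)

Section RelativeTiling.

Variable gT : finGroupType.
Hypothesis abG : abelian [set: gT].
Implicit Types (K L : {group gT}) (X E : {set gT}).

Let mulC (x y : gT) : x * y = y * x := mulgC_abelian abG x y.

(* E is a union of K-cosets, and X / K and E / K tile the quotient by K. *)
Definition rtiling K X E : Prop :=
  [/\ K \subset periods E, X * E = [set: gT] &
    forall x x' e e', x \in X -> x' \in X -> e \in E -> e' \in E ->
      x * e = x' * e' -> x^-1 * x' \in K].

Lemma rtiling1 X E : rtiling 1%G X E <-> tiling X E.
Proof.
split=> [[_ XE inj] | t].
  apply: tilingP => // a a' b b' aX a'X bE b'E /inj -/(_ aX a'X bE b'E) /set1P/eqP.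
  by rewrite -eq_invg_mul invgK => /eqP.
split; first by rewrite sub1G.
  by case: t.
move=> x x' e e' xX x'X eE e'E /(tiling_inj t xX x'X eE e'E)[-> _].
by rewrite mulVg group1.
Qed.

Lemma rtiling_translate K X E g : rtiling K X E -> rtiling K X (E :* g).
Proof.
case=> KE XE inj; split.
- apply/subsetP=> k /(subsetP KE) kE; apply/periodsP => _ /rcosetP[e eE ->].
  by rewrite -mulgA (mulC g) mulgA mem_rcoset mulgK mem_mul_periods.
- by rewrite mulgA XE; apply/setP=> z; rewrite mem_rcoset !inE.
- move=> x x' e e' xX x'X; rewrite !mem_rcoset => eE e'E eq_xe.
  by apply: inj xX x'X eE e'E _; rewrite !mulgA eq_xe.
Qed.

Lemma rtiling_based K X E : rtiling K X E -> exists2 E', rtiling K X E' & 1 \in E'.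
Proof.
move=> t; have [_ XE _] := t.
have /mulsgP[x e _ eE _] : 1 \in X * E by rewrite XE inE.
exists (E :* e^-1); first exact: rtiling_translate.
by rewrite mem_rcoset invgK mul1g.
Qed.

Lemma rtiling_quotient K X E : rtiling K X E -> tiling (X / K) (E / K).
Proof.
case=> KE XE inj; apply: tilingP.
  move=> u u' v v' /quotient_imageP[x xX ->] /quotient_imageP[x' x'X ->] /quotient_imageP[e eE ->].
  move=> /quotient_imageP[e' e'E ->]; rewrite -!cosetM // => /eqP; rewrite eq_coset // => k.
  apply/eqP; rewrite eq_coset //.
  apply: (inj _ _ (e * ((x * e)^-1 * (x' * e'))) e') => //.
    by rewrite mem_mul_periods ?(subsetP KE).
  by rewrite mulgA mulKVg.
apply/setP=> u; rewrite inE; case: (cosetP u) => g _ ->.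
have /mulsgP[x e xX eE ->] : g \in X * E by rewrite XE inE.
by rewrite cosetM // mem_mulg ?mem_coset.
Qed.

(** Descent through a (T1) step: the complement does not change. *)
Lemma rtiling_shrink K L X E : K \subset L ->
  (forall x y, x \in X -> y \in X -> x^-1 * y \in L -> x^-1 * y \in K) ->
  rtiling L X E -> rtiling K X E.
Proof.
move=> KL H [LE XE inj]; split=> //; first exact: subset_trans LE.
by move=> x x' e e' xX x'X eE e'E /inj-/(_ xX x'X eE e'E)/H; apply.
Qed.

(** Descent through a (T2) step: [f] marks a point in each [L]-coset, and from each such coset in
    [E] only the [K]-coset of the marked point is kept. As [X * K] is a union of [L]-cosets,
    covering is restored by changing the factor in [X]. *)
Lemma rtiling_lift K L X E (f : gT -> gT) : K \subset L -> L \subset periods (X * K) ->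
  (forall e, e^-1 * f e \in L) -> (forall e k, k \in L -> f (e * k) = f e) ->
  rtiling L X E -> rtiling K X [set e in E | e^-1 * f e \in K].
Proof.
move=> KL LX fL fM [LE XE inj]; split.
- apply/subsetP=> k kK; apply/periodsP => e; rewrite !inE => /andP[eE efK].
  rewrite mem_mul_periods ?(subsetP LE) ?(subsetP KL) //= fM ?(subsetP KL) //.
  by rewrite invMg -mulgA groupM ?groupV.
- apply/setP=> g; rewrite inE; have /mulsgP[x e xX eE ->] : g \in X * E by rewrite XE inE.
  (* The discrepancy between [e] and its marked point is absorbed into the factor from [X], up to
     [K]. *)
  have : x * (e^-1 * f e)^-1 \in X * K.
    by rewrite -(mul_periods_sub KL LX) mem_mulg ?groupV.
  case/mulsgP => y k yX kK eq_x.
  have -> : x * e = y * (f e * k).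
    by rewrite (mulC (f e)) mulgA -eq_x -mulgA invMg invgK (mulC (f e)^-1) mulgKV.
  rewrite mem_mulg // inE; have feE : f e \in E.
    by rewrite -[f e](mulKVg e) mem_mul_periods ?(subsetP LE).
  rewrite mem_mul_periods ?(subsetP LE) ?(subsetP KL) //= fM ?(subsetP KL) //.
  have -> : f (f e) = f e by rewrite -{1}[f e](mulKVg e) fM.
  by rewrite invMg -mulgA mulVg mulg1 groupV.
- move=> x x' e e' xX x'X; rewrite !inE => /andP[eE efK] /andP[e'E e'fK] eq_xe.
  have := inj _ _ _ _ xX x'X eE e'E eq_xe.
  have -> : x^-1 * x' = e * e'^-1.
    by apply: (mulgI x); rewrite mulKVg mulgA eq_xe mulgK.
  move=> eL; have fee : f e = f e' by rewrite -{1}(mulgKV e' e) mulC fM.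
  have -> : e * e'^-1 = (e'^-1 * f e') * (e^-1 * f e)^-1.
    by rewrite fee invMg invgK mulgA mulgK mulC.
  by rewrite groupM ?groupV.
Qed.

Lemma repr_section L : let f e := repr (coset L e) in
  (forall e, e^-1 * f e \in L) /\ (forall e k, k \in L -> f (e * k) = f e).
Proof.
split=> [e | e k kL]; last by rewrite coset_kerr.
by rewrite -eq_coset // coset_reprK.
Qed.

(** Source of (T1): as [x * (e * (x^-1 * y)) = y * e], a difference of [X] that is a period of [E]
    must lie in [K]. *)
Lemma rtiling_widen K X E : rtiling K X E ->
  rtiling (periods_group E) X E /\
  (forall x y, x \in X -> y \in X -> x^-1 * y \in periods E -> x^-1 * y \in K).
Proof.
case=> KE XE inj; split; first split=> //.
  by move=> x x' e e' xX x'X eE e'E /inj-/(_ xX x'X eE e'E)/(subsetP KE).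
move=> x y xX yX xyE; have /mulsgP[z e _ eE _] : 1 \in X * E by rewrite XE inE.
apply: (inj x y (e * (x^-1 * y)) e) => //; first exact: mem_mul_periods.
by rewrite (mulC e) !mulgA mulgV mul1g.
Qed.

(** Saturating [E] by the periods of [X * K] keeps a tiling, because translation by such a period
    can be undone within [X], up to [K]. *)
Lemma rtiling_project K X E : rtiling K X E ->
  let L := periods_group (X * K) in rtiling L X (E * L).
Proof.
case=> KE XE inj L; split; first exact: sub_periods_mul.
  by rewrite mulgA XE; apply/setP=> g; rewrite inE -[g]mulg1 mem_mulg ?inE ?rcoset1.
move=> x x' _ _ xX x'X /mulsgP[e k eE kL ->] /mulsgP[e' k' e'E k'L ->] eq_xe.
have : x' * (k' * k^-1) \in X * K.
  apply: mem_mul_periods; first by rewrite [_ \in _](@groupM _ L) ?groupV.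
  by rewrite -[x']mulg1 mem_mulg.
case/mulsgP => y h yX hK eq_y.
have xyK : x^-1 * y \in K.
  apply: inj xX yX eE (_ : e' * h \in E) _; first by rewrite mem_mul_periods ?(subsetP KE).
  rewrite (mulC e') mulgA -eq_y -mulgA (mulC _ e') !mulgA -(mulgA x') -eq_xe.
  by rewrite mulgA mulgK.
have -> : x' = y * (h * (k' * k^-1)^-1) by rewrite mulgA -eq_y mulgK.
have KL : K \subset L := sub_periods_mul K X.
rewrite mulgA; apply: (@groupM _ L); first exact: (subsetP KL).
apply: (@groupM _ L); first exact: (subsetP KL).
by rewrite (@groupV _ L) (@groupM _ L) // (@groupV _ L).
Qed.

End RelativeTiling.

(** * From an admissible series to a tiling *)

Section SeriesToTiling.

Variable gT : finGroupType.
Hypothesis abG : abelian [set: gT].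
Implicit Types (K L : {group gT}) (X E : {set gT}).

(** The whole group is a complement relative to the last member; each pair of members is then
    descended by one [rtiling_lift] and one [rtiling_shrink]. *)
Lemma series_rtiling X t (H : nat -> {group gT}) : 1 \in X ->
  (forall i, i < t.*2 -> H i \subset H i.+1) -> H t.*2 = [set: gT]%G ->
  T1 X t H -> T2 X t H -> exists E, rtiling (H 0) X E.
Proof.
move=> X1; elim: t H => [|t IH] H sub HT t1 t2.
  exists [set: gT]; rewrite [H 0]HT; split.
  - by apply/subsetP=> z _; apply/periodsP => x; rewrite !inE.
  - by apply/setP=> g; rewrite inE -[g]mul1g mem_mulg ?inE.
  - by move=> *; rewrite inE.
have [] := IH (fun i => H i.+2).
- by move=> i lt_i; apply: sub; rewrite doubleS.
- by rewrite -HT doubleS.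
- by move=> i lt_i; apply: (t1 i.+1).
- by case=> // i lt_i; apply: (t2 i.+2).
move=> E tE.
have sub01 : H 0 \subset H 1%N by apply: sub; rewrite doubleS.
have sub12 : H 1%N \subset H 2 by apply: sub; rewrite doubleS.
have [_ p12] := t2 1%N isT.
have {}p12 := (periods_quotientE abG X sub12).1 p12.
have [f1 f2] := repr_section abG (H 2).
have sub2 : H 2 \subset periods (X * H 1%N) by rewrite p12.
have tE1 := rtiling_lift abG sub12 sub2 f1 f2 tE.
eexists; apply: (rtiling_shrink sub01 _ tE1).
exact/(diff_quotientP abG sub01 X1)/(t1 0).
Qed.

Lemma quotient_rtiling K X (E : {set coset_of K}) : tiling (X / K) E ->
  rtiling K X [set g | coset K g \in E].
Proof.
move=> tE; split.
- by apply/subsetP=> k kK; apply/periodsP => x; rewrite !inE coset_kerr.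
- apply/setP=> g; rewrite inE.
  have [u [v [/quotient_imageP[x xX ->] vE e]]] := tiling_decomp (coset K g) tE.
  rewrite -[g](mulKVg x) mem_mulg // inE cosetM //.
  by rewrite e mulgA -cosetM // mulVg coset_id ?mul1g.
- move=> x x' e e' xX x'X; rewrite !inE => eE e'E eq_xe.
  have [|/eqP] := tiling_inj tE (mem_coset abG K xX) (mem_coset abG K x'X) eE e'E.
    by rewrite -!cosetM // eq_xe.
  by rewrite eq_coset.
Qed.

End SeriesToTiling.

Lemma pyramidal_tiling (gT : finGroupType) (X : {set gT})
    (abG : abelian [set: gT]) :
  pyramidal [set: gT]%G X -> exists2 E, tiling X E & 1 \in E.
Proof.
case=> _ _ X1 [t [H [t_gt0 [proper_H sub_last HT]]]] adm.
have sub i : i < t.*2 -> H i \subset H i.+1.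
  move=> lt_i; have [lt|] := ltnP i t.*2.-1; first exact/proper_sub/proper_H.
  move=> le; have -> // : i = t.*2.-1.
    by apply/eqP; rewrite eqn_leq le andbT -ltnS prednK // (leq_ltn_trans _ lt_i).
  by rewrite prednK ?sub_last // (leq_ltn_trans _ lt_i).
suff [E tE] : exists E, rtiling 1%G X E.
  by have [E' /rtiling1] := rtiling_based abG tE; exists E'.
case: adm => [[H0 _ [t1 t2 _]] | [_ [_ pX] [t1 t2 _]]].
  have [E tE] := series_rtiling abG X1 sub HT t1 t2; exists E.
  by have -> : 1%G = H 0 by apply/val_inj/esym.
have abQ : abelian [set: coset_of (H 0)] by rewrite -quotientT quotient_abelian.
have [] := @series_rtiling (coset_of (H 0)) abQ (X / H 0) t (fun i => (H i / H 0)%G).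
- by rewrite -(morph1 (coset_morphism (H 0))); apply: mem_coset.
- by move=> i lt_i; apply: quotientS; apply: sub.
- by apply: val_inj; rewrite /= HT quotientT.
- exact: t1.
- exact: t2.
move=> Eq; have -> : (H 0 / H 0)%G = 1%G by apply: val_inj; rewrite /= trivg_quotient.
move/rtiling1/(quotient_rtiling abG) => tE.
(* As [X] is itself a union of [H 0]-cosets, one representative of each coset of the complement
   suffices. *)
have [f1 f2] := repr_section abG (H 0).
eexists; apply: (rtiling_lift abG (sub1G _) _ f1 f2 tE).
by rewrite mulg1 pX.
Qed.

(** * From a tiling to an admissible series *)

Section TilingToSeries.

Variables (gT : finGroupType) (p : nat).
Hypotheses (cycG : cyclic [set: gT]) (p_pr : prime p).
Implicit Types (K L : {group gT}) (X E : {set gT}).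

Let abG : abelian [set: gT] := cyclic_abelian cycG.

Lemma rtiling_periodic K X E : p.-nat #|X / K| -> K \proper [set: gT] ->
  rtiling K X E ->
  (exists2 z, z \in periods (X * K) & z \notin K) \/
  (exists2 z, z \in periods E & z \notin K).
Proof.
move=> pX /properP[_ [g _ gK]] tE; have tQ := rtiling_quotient abG tE.
have cycQ : cyclic [set: coset_of K] by rewrite -quotientT quotient_cyclic.
have n1 z : coset K z != 1 -> z \notin K by apply: contraNN => /coset_id ->.
have Q_gt1 : 1 < #|{: coset_of K}|.
  rewrite -cardsT cardG_gt1; apply/trivgPn; exists (coset K g); rewrite ?inE //.
  by apply: contraNneq gK => /eqP; rewrite -(morph1 (coset_morphism K)) eq_sym eq_coset // invg1 mul1g.
have EK : E * K = E.
  have [KE _ _] := tE; apply/setP=> e; apply/mulsgP/idP => [[x k xE kK ->] | eE].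
    by rewrite mem_mul_periods ?(subsetP KE).
  by exists e 1; rewrite ?mulg1.
case: (periodic_factor cycQ p_pr tQ pX Q_gt1) => [] [u]; case: (cosetP u) => z _ ->.
  by rewrite mem_periods_quotient // => zX /n1 zK; left; exists z.
by rewrite mem_periods_quotient // EK => zE /n1 zK; right; exists z.
Qed.

Definition series_cons K L (H : nat -> {group gT}) i : {group gT} :=
  match i with 0 => K | 1 => L | j.+2 => H j end.

(** Induction on [#|gT| - #|K|]. The next two members are the periods [L] of [E] and [M] of [X * L];
    each is strictly larger because [rtiling_periodic] gives a new period of one factor while the
    other has none left. The value of [H 1] is recorded for the uniqueness of the code when
    [t = 1]. *)
Lemma tiling_series K X E : 1 \in X -> <<X>> = [set: gT] -> p.-nat #|X / K| ->
  K \proper [set: gT] -> periods (X * K) = K -> rtiling K X E ->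
  exists t H, [/\ 0 < t, H 0 = K, H 1%N = periods_group E,
    subgroup_series [set: gT]%G t H & T123 [set: gT]%G X t H].
Proof.
move=> X1 genX; have [m] := ubnP (#|gT| - #|K|).
elim: m K E => // m IH K E le_m pX prK perK tE.
have [tE1 t1] := rtiling_widen abG tE.
set L := periods_group E in tE1 *.
have KL : K \subset L by case: tE.
have prKL : K \proper L.
  apply/properP; split=> //; have [] := rtiling_periodic pX prK tE; last first.
    by move=> [z zE zK]; exists z.
  by case=> z; rewrite perK => ->.
(* If [L] were the whole group, all of [X] would lie in the proper subgroup [K], although [X]
   generates the group. *)
have prL : L \proper [set: gT].
  rewrite properE subsetT /=; apply: contraNN (proper_subn prK) => LT.
  rewrite -genX gen_subG; apply/subsetP=> x xX.
  rewrite -[x]mul1g -invg1; apply: t1 => //.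
  by apply: (subsetP LT); rewrite inE.
have pXL : p.-nat #|X / L| by rewrite -(card_quotient_inj abG KL t1).
have tE2 := rtiling_project abG tE1; set M := periods_group (X * L) in tE2.
have LM : L \subset M := sub_periods_mul L X.
have prLM : L \proper M.
  apply/properP; split=> //; have [[z zX zK]|[z zE zL]] := rtiling_periodic pXL prL tE1.
    by exists z.
  by rewrite zE in zL.
have T1h : (X / K) * (X / K)^-1 :&: (L / K) = 1 by apply/(diff_quotientP abG KL X1).
have T2h : periodic_with (M / L) (X / L).
  split; last exact/(periods_quotientE abG X LM).
  rewrite -subG1 quotient_sub1 ?(proper_subn prLM) //.
  by apply/subsetP=> x _; exact: abelian_norm.
have T3h : #|X / K| = #|X / L| := card_quotient_inj abG KL t1.
have XLM : X * M = X * L := mul_periods_sub LM (subxx M).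
(* The series stops once [M] is the whole group; otherwise it continues with the complement
   [E * M]. *)
have [MT | prM] := boolP ([set: gT] \subset M).
  have eM : M = [set: gT]%G by apply/val_inj/eqP; rewrite eqEsubset subsetT.
  exists 1%N, (series_cons K L (fun=> [set: gT]%G)); split=> //.
    by split=> [[]||] //; apply: subsetT.
  split; first by case.
    by case=> [|[]] // _; rewrite -eM.
  split; last by case.
  apply: eq_card => u; case: (cosetP u) => x _ ->.
  rewrite !mem_coset_quotient // -XLM eM.
  have -> : x \in X * [set: gT] by rewrite -[x]mul1g mem_mulg ?inE.
  by rewrite -[x]mulg1 mem_mulg ?group1 ?in_setT.
have prMT : M \proper [set: gT] by rewrite properE subsetT.
have [|||t [H [t_gt0 H0 H1 [prH lastH HT] [t1' t2' [t3 t3']]]]] := IH M (E * M) _ _ prMT _ tE2.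
- apply: leq_trans (le_m : #|gT| - #|K| <= m); apply: ltn_sub2l.
    by rewrite -cardsT proper_card.
  exact: proper_card (proper_trans prKL prLM).
- exact: pnat_dvd (card_quotient_dvdn abG LM (subxx M)) pXL.
- by rewrite XLM.
case: t t_gt0 prH lastH HT t1' t2' t3 t3' => // t _ prH lastH HT t1' t2' t3 t3'.
exists t.+2, (series_cons K L H); split=> //.
- split=> //; case=> [|[|i]] lt_i //; first by rewrite /= H0.
  by apply: prH; rewrite !doubleS /= in lt_i *.
split.
- by case=> [|i] lt_i //; apply: t1'.
- by case=> [|[|i]] // lt_i; [rewrite /= H0 | apply: (t2' i.+1)].
- by split=> //; case=> [|i] lt_i //; apply: t3'.
Qed.

End TilingToSeries.

Lemma T123_ext (gT : finGroupType) (G : {group gT}) (X : {set gT}) t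
    (H H' : nat -> {group gT}) :
  (forall i, H i = H' i) -> T123 G X t H' -> T123 G X t H.
Proof.
move=> eH [t1 t2 [t3 t3']]; split.
- by move=> i lt_i; rewrite !eH; apply: t1.
- by move=> i lt_i; rewrite !eH; apply: t2.
- by split=> [|i lt_i]; rewrite !eH //; apply: t3'.
Qed.

Lemma aperiodic_series (gT : finGroupType) (p : nat) (X E : {set gT}) :
  cyclic [set: gT] -> prime p -> 1 \in X -> <<X>> = [set: gT] -> p.-nat #|X| ->
  X != [set: gT] -> aperiodic X -> tiling X E ->
  exists t H, [/\ 0 < t, H 0 = 1%G, H 1%N = periods_group E,
    subgroup_series [set: gT]%G t H & T123 [set: gT]%G X t H].
Proof.
move=> cycG p_pr X1 genX pX XnT apX /rtiling1 tE.
have G_n1 : 1%G \proper [set: gT].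
  rewrite properE subsetT /=; apply: contraNN XnT => GT; rewrite eqEsubset subsetT.
  by apply: subset_trans GT _; rewrite sub1set.
have pX1 : p.-nat #|X / 1%G|.
  have := card_mul_quotient (cyclic_abelian cycG) 1%G X.
  by rewrite mulg1 cards1 muln1 => <-.
have perX : periods (X * 1%G) = 1%G by rewrite mulg1.
exact: tiling_series pX1 G_n1 perX tE.
Qed.

Lemma aperiodic_admissible (gT : finGroupType) (p : nat) (X E : {set gT}) :
  cyclic [set: gT] -> prime p -> 1 \in X -> <<X>> = [set: gT] -> p.-nat #|X| ->
  X != [set: gT] -> aperiodic X -> tiling X E ->
  exists t H, admissible [set: gT]%G X t H /\ H 1%N = periods_group E.
Proof.
move=> cycG p_pr X1 genX pX XnT apX tE.
have [t [H [t_gt0 H0 H1 serH tH]]] := aperiodic_series cycG p_pr X1 genX pX XnT apX tE.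
by exists t, H; split=> //; split=> //; left; rewrite H0.
Qed.

Lemma tiling_pyramidal (gT : finGroupType) (p : nat) (X E : {set gT}) :
  cyclic [set: gT] -> prime p -> 1 \in X -> <<X>> = [set: gT] -> p.-nat #|X| ->
  X != [set: gT] -> tiling X E -> pyramidal [set: gT]%G X.
Proof.
move=> cycG p_pr X1 genX pX XnT tE; have abG := cyclic_abelian cycG.
split; rewrite ?subsetT //.
have [apX | nap] := eqVneq (periods X) 1.
  have [t [H []]] := aperiodic_admissible cycG p_pr X1 genX pX XnT apX tE.
  by exists t, H.
pose K := periods_group X.
have tK : tiling (X / K) ((E * K) / K).
  have /rtiling1/(rtiling_project abG) := tE.
  have -> : periods_group (X * 1%G) = K by apply: val_inj; rewrite /= mulg1.
  exact: rtiling_quotient.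
have XK : X * K = X.
  apply/setP=> x; apply/mulsgP/idP => [[y k yX kK ->]|xX]; first exact: mem_mul_periods.
  by exists x 1; rewrite ?mulg1 ?group1.
have cycQ : cyclic [set: coset_of K] by rewrite -quotientT quotient_cyclic.
have [|||||t [H [t_gt0 H0 _ [prH lastH HT] tH]]] := aperiodic_series cycQ p_pr _ _ _ _ _ tK.
- by rewrite -(morph1 (coset_morphism K)); apply: mem_coset.
- rewrite -quotient_gen ?genX ?quotientT //.
  by apply/subsetP=> x _; apply: abelian_norm.
- apply: pnat_dvd pX; have := card_mul_quotient abG K X; rewrite XK => ->.
  exact: dvdn_mulr.
- apply: contraNneq XnT => XKT; apply/eqP/setP => x.
  by have := mem_coset_quotient abG K X x; rewrite XK XKT !inE => <-.
- rewrite /aperiodic -[1](trivg_quotient K).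
  by apply/(periods_quotientE abG X (subxx K)); rewrite XK.
(* The value at 0 is [K] by computation, not merely the preimage of 1, so that the quotient by
   [H' 0] is convertible to the quotient by [K]. *)
pose H' i : {group gT} := if i is 0 then K else (coset K @*^-1 (H i))%G.
have H'E i : H' i = coset K @*^-1 (H i) :> {set gT}.
  by case: i => //=; rewrite H0 cosetpre1.
exists t, H'; split=> //.
  split=> [i lt_i||].
  - by rewrite !H'E cosetpre_proper prH.
  - by rewrite !H'E cosetpreSK.
  - apply: val_inj; rewrite /= H'E HT; apply/setP=> x.
    by rewrite mem_morphpre ?abelian_norm // !inE.
right; split; first exact/eqP.
  by split.
have -> : ([set: gT] / K)%G = [set: coset_of K]%G by apply: val_inj; exact: quotientT.
apply: T123_ext tH => i; apply: val_inj.
by case: i => [|i]; rewrite /= ?H0 ?trivg_quotient ?cosetpreK.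
Qed.

(** * Uniqueness of subgroup complements, and complements that are not subgroups *)

Section Codes.

Variables (gT : finGroupType) (X : {set gT}).
Hypotheses (cycG : cyclic [set: gT]) (X1 : 1 \in X).

Let abG : abelian [set: gT] := cyclic_abelian cycG.

(** The order of a subgroup tile is determined by [#|X|], and a cyclic group has at most one
    subgroup of each order. *)
Lemma eq_subgroup_tiles (A B : {set gT}) (K L : {group gT}) :
  tiling X A -> tiling X B -> A = K -> B = L -> A = B.
Proof.
move=> [_ cA] [_ cB] eA eB; rewrite eA eB; apply/eqP.
rewrite (eq_subG_cyclic cycG) ?subsetT // -eA -eB.
have X_gt0 : 0 < #|X| by apply/card_gt0P; exists 1.
by rewrite -(eqn_pmul2l X_gt0) cA cB.
Qed.

Lemma nongroup_tiling t (H : nat -> {group gT}) : 1 < t ->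
  subgroup_series [set: gT]%G t H -> H 0 = 1%G -> T123 [set: gT]%G X t H ->
  exists E, [/\ tiling X E, 1 \in E & ~ exists K : {group gT}, E = K].
Proof.
case: t => [|[|t]] // _ [prH lastH HT] H0 [t1 t2 _].
have sub i : i < t.+1.*2.+2 -> H i \subset H i.+1.
  rewrite ltnS leq_eqVlt => /predU1P[-> //|lt_i]; exact/proper_sub/prH.
have [E0 tE0] : exists E, rtiling (H 2) X E.
  apply: (@series_rtiling gT abG X t.+1 (fun i => H i.+2)) => //.
  - by move=> i lt_i; apply: sub.
  - by move=> i lt_i; apply: (t1 i.+1).
  - by case=> // i lt_i; apply: (t2 i.+2).
have [E tE E1] := rtiling_based abG tE0.
have sub01 : H 0 \subset H 1%N by apply: sub.
have sub12 : H 1%N \subset H 2 by apply: sub.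
have sub23 : H 2 \subset H 3 by apply: sub.
have sub2 : H 2 \subset periods (X * H 1%N).
  by have [_ /(periods_quotientE abG X sub12) ->] := t2 1%N isT.
(* Write some [z] in [H 3] outside [H 2] as [x * e]. If [e] were in [H 2], then [x] would be in
   [H 3], hence in [H 2] by (T1), and so would [z]. *)
have [e eE eH] : exists2 e, e \in E & e \notin H 2.
  apply/subsetPn/negP => EH; have /properP[_ [z zH3 zH2]] := prH 2 isT.
  have [_ XE _] := tE; have /mulsgP[x e xX eE ze] : z \in X * E by rewrite XE inE.
  have eH := subsetP EH _ eE; case/negP: zH2; rewrite ze groupMr //.
  have := (diff_quotientP abG sub23 X1).1 (t1 1%N isT) 1 x X1 xX.
  by rewrite invg1 mul1g; apply; rewrite -(groupMr x (subsetP sub23 _ eH)) -ze.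
have /properP[_ [k kH2 kH1]] := prH 1%N isT.
have [r1 r2] := repr_section abG (H 2).
(* The liftings of E given by the sections f 1 and f k both contain 1 but
   differ on the coset of e; as a cyclic group has at most one subgroup of a
   given order, they cannot both be subgroups. *)
pose f g e := if e \in H 2 then 1 else repr (coset (H 2) e) * g.
have f1 g x : g \in H 2 -> x^-1 * f g x \in H 2.
  move=> gH; rewrite /f; case: ifP => xH; first by rewrite mulg1 groupV.
  by rewrite mulgA groupM.
have f2 g x y : y \in H 2 -> f g (x * y) = f g x.
  by move=> yH; rewrite /f groupMr // coset_kerr.
pose F g := [set x in E | x^-1 * f g x \in H 1%N].
have tF g : g \in H 2 -> tiling X (F g).
  move=> gH; apply/rtiling1; rewrite -H0; apply: (rtiling_shrink sub01).
    by apply/(diff_quotientP abG sub01 X1); apply: (t1 0%N).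
  by apply: (rtiling_lift abG sub12 sub2 _ _ tE) => [x|x y]; [apply: f1 | apply: f2].
have F1 g : 1 \in F g by rewrite inE E1 /f group1 invg1 mulg1 group1.
have neqF : F 1 != F k.
  apply: contraNneq kH1 => eqF.
  have reH : repr (coset (H 2) e) \in H 2 = false.
    by apply: negbTE; apply: contraNN eH => rH; rewrite -groupV -(groupMr _ rH).
  have fr g : f g (repr (coset (H 2) e)) = repr (coset (H 2) e) * g.
    by rewrite /f reH coset_reprK.
  have [perE _ _] := tE.
  have rE : repr (coset (H 2) e) \in E.
    by rewrite -(mulKVg e (repr _)) mem_mul_periods ?(subsetP perE).
  have : repr (coset (H 2) e) \in F 1 by rewrite inE rE fr mulKg group1.
  by rewrite eqF inE rE fr mulKg.
have [/existsP [K /eqP FK] | noK] := boolP [exists K : {group gT}, F 1 == K].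
  exists (F k); split; [exact: tF | exact: F1 | case=> L FL; case/eqP: neqF].
  by apply: eq_subgroup_tiles FK FL; apply: tF; rewrite ?group1.
exists (F 1); split; [exact: tF | exact: F1 | case=> K FK].
by case/existsP: noK; exists K; rewrite FK.
Qed.

(** By the equality of sizes, [X] meets every coset of the periods of [E], so [e = x * z] with [z] a
    period, hence in [E]; uniqueness against [1 * e] gives [e = z]. *)
Lemma tiling_periods_full E : tiling X E -> 1 \in E ->
  #|X / periods_group E| = #|[set: gT] / periods_group E| -> E = periods E.
Proof.
move=> tE E1 cX; have XT : X / periods_group E = [set: gT] / periods_group E.
  by apply/eqP; rewrite eqEcard cX leqnn quotientS ?subsetT.
apply/setP=> e; apply/idP/idP => [eE | eP]; last first.
  by rewrite -[e]mul1g mem_mul_periods.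
have : e \in X * periods_group E.
  by rewrite -mem_coset_quotient // XT mem_coset // inE.
case/mulsgP => x z xX zP eq_e; have zE : z \in E by rewrite -[z]mul1g mem_mul_periods.
have [|_ ->] // := tiling_inj tE X1 xX eE zE.
by rewrite mul1g.
Qed.

End Codes.

(** * Perfect codes in Cayley graphs as tilings *)

Section CayleyGraphs.

Variables (gT : finGroupType) (S : {set gT}).

Lemma dist_le1P x y : dist_le (cay S) 1 x y <-> x * y^-1 \in 1 |: S.
Proof.
split=> [[[|z [|? ?]] [] //= px <- _] | ].
- by rewrite mulgV setU11.
- by rewrite andbT in px; rewrite setU1r.
case/setU1P => [/eqP | xyS].
  by rewrite -eq_mulgV1 => /eqP ->; exists [::].
by exists [:: y]; split; rewrite //= andbT.
Qed.

Lemma perfect_codeP D : perfect_code (cay S) D <-> tiling (1 |: S) D.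
Proof.
split=> [pc | t].
  apply: tilingP.
    move=> a a' d d' aS a'S dD d'D e; have [d0 [_ u]] := pc (a * d).
    have e1 : d0 = d by apply: u; split=> //; apply/dist_le1P; rewrite mulgK.
    have e2 : d0 = d' by apply: u; split=> //; apply/dist_le1P; rewrite e mulgK.
    by move: e; rewrite -e1 -e2 => /mulIg.
  apply/setP=> x; rewrite inE; have [d [[dD /dist_le1P xd] _]] := pc x.
  by rewrite -[x](mulgKV d) mem_mulg.
move=> x; have [a [d [aS dD ->]]] := tiling_decomp x t.
exists d; split; first by split=> //; apply/dist_le1P; rewrite mulgK.
move=> d' [d'D /dist_le1P ad'].
by have [|_ ->] := tiling_inj t aS ad' dD d'D; rewrite ?mulgKV.
Qed.

Lemma connected_cay_gen : connected_graph (cay S) -> <<1 |: S>> = [set: gT].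
Proof.
move=> conn; apply/setP=> y; rewrite inE.
suff sub (G : {group gT}) : (forall z, z \in S -> z \in G) -> y \in G.
  by apply: (sub (generated_group (1 |: S))) => z zS; rewrite mem_gen // setU1r.
move=> SG; have /connectP[s ps ->] := conn 1 y.
elim: s (1 : gT) (group1 G) ps => //= z s IH x xG /andP[/SG xz pz]; apply: IH pz.
by rewrite -groupV -(groupMl _ xG).
Qed.

Lemma complete_cay : 1 |: S = [set: gT] -> complete_graph (cay S).
Proof.
move=> ST x y; rewrite eq_mulgV1 => xy.
by have : x * y^-1 \in 1 |: S by [rewrite ST inE]; rewrite in_setU1 (negbTE xy).
Qed.

End CayleyGraphs.

(** * Subgroups as tiling complements *)

Section SubgroupTiling.

Variables (gT : finGroupType) (X : {set gT}) (K : {group gT}).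
Hypotheses (abG : abelian [set: gT]) (X1 : 1 \in X).

Lemma subgroup_tiling_diff : tiling X K -> X * X^-1 :&: K = 1.
Proof.
move=> t; apply/setP=> z; rewrite !inE; apply/andP/eqP => [[] | ->].
  case/mulsgP => x w xX; rewrite mem_invg => wX -> zK.
  have [|-> _] := tiling_inj t xX wX (group1 K) zK; last by rewrite mulVg.
  by rewrite mulg1 (mulgC_abelian abG x) mulKg.
by rewrite group1 -[1](mulgV 1) mem_mulg ?mem_invg ?invgK.
Qed.

(** The trivial intersection makes multiplication injective on pairs from [X] and [K]; counting
    makes it onto. *)
Lemma diff_subgroup_tiling : X * X^-1 :&: K = 1 -> (#|X| * #|K| = #|gT|)%N -> tiling X K.
Proof.
move=> XK cXK; split=> //; apply/eqP; rewrite -subTset.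
pose f (u : gT * gT) := u.1 * u.2.
have fXK : f @: setX X K \subset X * K.
  by apply/subsetP=> _ /imsetP[[x k] /setXP[xX kK] ->]; rewrite mem_mulg.
apply: subset_trans fXK; rewrite subTset eqEcard subsetT cardsT -cXK -cardsX.
rewrite card_in_imset ?leqnn // => -[x k] [x' k'] /setXP[xX kK] /setXP[x'X k'K]; rewrite /f /= => e.
have : x * x'^-1 \in X * X^-1 :&: K.
  rewrite inE mem_mulg ?mem_invg ?invgK //=.
  have -> : x * x'^-1 = k' * k^-1; last by rewrite groupM ?groupV.
  by apply: (mulIg k); rewrite mulgKV -(mulgA x) (mulgC_abelian abG x'^-1) mulgA e
       (mulgC_abelian abG x') mulgK.
rewrite XK => /set1P/eqP; rewrite -eq_mulgV1 => /eqP ex.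
by move: e; rewrite ex => /mulgI ->.
Qed.

End SubgroupTiling.

Theorem theorem1p2 (n p l : nat) (S : {set 'Z_n})
    (n_ge3 : (3 <= n)%N) (p_prime : prime p) (l_ge1 : (1 <= l)%N)
    (S_not0 : 0%R \notin S)
    (S_opp : forall x : 'Z_n, x \in S -> (- x)%R \in S)
    (Gconn : connected_graph (cay S))
    (Gncomp : ~ complete_graph (cay S))
    (Gdeg : #|S| = (p ^ l - 1)%N) :
  let S0 : {set 'Z_n} := 0%R |: S in
  let P : {group 'Z_n} := <[ ((p ^ l)%:R : 'Z_n)%R ]>%G in
  ((exists D : {set 'Z_n}, perfect_code (cay S) D) <->
   (p ^ l %| n)%N /\ pyramidal [set: 'Z_n]%G S0) /\
  ((p ^ l %| n)%N -> pyramidal [set: 'Z_n]%G S0 -> aperiodic S0 ->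
   forall t : nat, longest_half_length [set: 'Z_n]%G S0 t ->
   ((S0 * S0^-1)%g :&: P = [set 0%R] ->
    [/\ perfect_code (cay S) P,
        0%R \in P,
        t = 1%N -> forall D : {set 'Z_n},
          perfect_code (cay S) D -> 0%R \in D -> D = P
      & (1 < t)%N -> exists D : {set 'Z_n},
          [/\ perfect_code (cay S) D, 0%R \in D
            & ~ exists K : {group 'Z_n}, D = K]]) /\
   ((S0 * S0^-1)%g :&: P <> [set 0%R] ->
    (exists D : {set 'Z_n}, perfect_code (cay S) D /\ 0%R \in D) /\
    (forall D : {set 'Z_n},
       perfect_code (cay S) D -> 0%R \in D -> D <> P))).
Proof.
move=> S0 P.
have n_gt1 : 1 < n by apply: leq_trans n_ge3.
have cardG : #|'Z_n| = n by rewrite card_ord Zp_cast.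
have cycG : cyclic [set: 'Z_n] by apply/cyclicP; exists Zp1; apply: Zp_cycle.
have abG := cyclic_abelian cycG.
have cardS0 : #|S0| = (p ^ l)%N.
  by rewrite cardsU1 S_not0 Gdeg subnKC // expn_gt0 prime_gt0.
have X1 : 1 \in S0 by exact: setU11.
have pX : p.-nat #|S0| by rewrite cardS0 pnatX pnat_id.
have genX : <<S0>> = [set: 'Z_n] := connected_cay_gen Gconn.
have XnT : S0 != [set: 'Z_n] by apply/eqP => /complete_cay.
have codeP D : perfect_code (cay S) D <-> tiling S0 D := perfect_codeP S D.
split.
  split=> [[D /codeP tD] | [_ /(pyramidal_tiling abG)[D tD _]]].
    split; last exact: tiling_pyramidal cycG p_prime X1 genX pX XnT tD.
    by have [_ /esym] := tD; rewrite cardG cardS0 => ->; apply: dvdn_mulr.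
  by exists D; apply/codeP.
move=> pl_n pyr apX t [[H admH] longest].
have cardP : #|P| = (n %/ p ^ l)%N.
  (* The residue of [p ^ l] is, in multiplicative notation, the [p ^ l]-th power of the generator
     [Zp1]. *)
  have -> : P = <[(Zp1 : 'Z_n) ^+ (p ^ l)]> :> {set _} by [].
  have o1 : #[(Zp1 : 'Z_n)] = n by rewrite order_Zp1 Zp_cast.
  by rewrite -orderE orderXdiv ?o1.
have tP : S0 * S0^-1 :&: P = 1 -> tiling S0 P.
  move=> dP; apply: diff_subgroup_tiling dP _ => //.
  by rewrite cardS0 cardP cardG mulnC divnK.
split=> [dP | ndP].
  split.
  - exact/codeP/tP.
  - exact: group1.
  - move=> t1 D /codeP tD D1.
    (* Every code [D] gives a series whose [H' 1] is the group of periods of [D]. As the longest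
       length is 2, (T3) makes [S0] meet all cosets of these periods, so [D] is a subgroup. *)
    have [t' [H' [adm' H1]]] := aperiodic_admissible cycG p_prime X1 genX pX XnT apX tD.
    have t'1 : t' = 1%N.
      by have := longest _ _ adm'; have [] := adm'; rewrite t1; case: (t') => [|[]].
    have [_ _ ad] := adm'; rewrite t'1 in ad.
    have cX : #|S0 / periods_group D| = #|[set: 'Z_n] / periods_group D|.
      case: ad => [[_ _ [_ _ [c3 _]]] | [H0n [_ perX] _]]; first by rewrite -H1.
      by case: H0n; rewrite -perX.
    have DP := tiling_periods_full cycG X1 tD D1 cX.
    exact: (eq_subgroup_tiles cycG X1 tD (tP dP) (K := periods_group D) (L := P)).
  - move=> t_gt1; have [_ serH [[H0 _ tH] | [H0n [_ perX] _]]] := admH; last first.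
      by case: H0n; rewrite -perX.
    have H01 : H 0 = 1%G by apply: val_inj.
    have [E [tE E1 nE]] := nongroup_tiling cycG X1 t_gt1 serH H01 tH.
    by exists E; split=> //; apply/codeP.
split.
  by have [E tE E1] := pyramidal_tiling abG pyr; exists E; split=> //; apply/codeP.
by move=> D /codeP tD _ DP; case: ndP; apply: subgroup_tiling_diff; rewrite // -DP.
Qed.
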